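(* Let $n\ge 3$. (1) $\mathcal{PI}^{\ast}_n$ is generated as an inverse semigroup by $\mathcal{S}_n\cup\{\gamma_{1,2}\}$. (2) For $u\in\mathcal{PI}^{\ast}_n\setminus\mathcal{S}_n$, $\mathcal{PI}^{\ast}_n$ is generated as an inverse semigroup by $\mathcal{S}_n\cup\{u\}$ if and only if $u\in \mathcal{S}_n\{\gamma_{1,2},\gamma_{1,2}^{-1}\}\mathcal{S}_n=\{g\star v\star h: g,h\in\mathcal{S}_n,\ v\in\{\gamma_{1,2},\gamma_{1,2}^{-1}\}\}$.
   Context: Let $X=\{1,\dots,n\}$, $X'=\{1',\dots,n'\}$ a disjoint copy. $\mathcal{PI}^{\ast}_n$ is the set of partitions of $X\cup X'$ each of whose blocks is a singleton (point) or a generalised line (a set meeting both $X$ and $X'$), with product $\star$: with $X''$ a third copy of $X$, regard $\alpha$ as a partition of $X\cup X''$ and $\beta$ as a partition of $X''\cup X'$, let $\sim$ be the equivalence relation on $X\cup X''\cup X'$ generated by the blocks of both; $\alpha\star\beta$ is the partition of $X\cup X'$ in which distinct $u,v$ lie in one block iff $u\sim v$ and the $\sim$-class of $u$ contains no singleton block of $\alpha$ or $\beta$. This is an inverse semigroup; the inverse of the element with generalised lines $A_i\cup B_i'$ is the element with generalised lines $B_i\cup A_i'$. $\mathcal{S}_n$ is its group of units: the elements all of whose blocks are of the form $\{x,\pi(x)'\}$ for a permutation $\pi$ of $X$. $\gamma_{1,2}$ is the element with blocks $\{1,2,1'\}$, $\{2'\}$, and $\{t,t'\}$ for $3\le t\le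 n$. *)

(* Defs.v *)
From mathcomp Require Import all_boot perm.
Set Implicit Arguments. Unset Strict Implicit. Unset Printing Implicit Defensive.

(* Points of X ∪ X': inl x = x \in X, inr x = x' \in X'. *)
Definition pt (n : nat) : finType := ('I_n + 'I_n)%type.

Definition isPI (n : nat) (a : {set {set pt n}}) : Prop :=
  partition a [set: pt n] /\
  (forall B, B \in a ->
     #|B| = 1 \/ ((exists x, inl x \in B) /\ (exists y, inr y \in B))).

(* Three copies X (tag 0), X'' (tag 1), X' (tag 2). *)
Definition tri (n : nat) : finType := ('I_n * 'I_3)%type.
Definition t0 : 'I_3 := @Ordinal 3 0 isT.
Definition t1 : 'I_3 := @Ordinal 3 1 isT.
Definition t2 : 'I_3 := @Ordinal 3 2 isT.

(* alpha regarded on X ∪ X'' ; beta on X'' ∪ X' ; result on X ∪ X' *)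
Definition embA n (p : pt n) : tri n :=
  match p with inl x => (x, t0) | inr x => (x, t1) end.
Definition embB n (p : pt n) : tri n :=
  match p with inl x => (x, t1) | inr x => (x, t2) end.
Definition embR n (p : pt n) : tri n :=
  match p with inl x => (x, t0) | inr x => (x, t2) end.

Definition genrel n (a b : {set {set pt n}}) : rel (tri n) :=
  fun u v => [exists B in a, (u \in @embA n @: B) && (v \in @embA n @: B)] ||
             [exists B in b, (u \in @embB n @: B) && (v \in @embB n @: B)].

Definition simrel n (a b : {set {set pt n}}) : rel (tri n) :=
  connect (genrel a b).

Definition has_point n (a b : {set {set pt n}}) (u : tri n) : bool :=
  [exists t : pt n, ([set t] \in a) && simrel a b u (embA t)] ||
  [exists t : pt n, ([set t] \in b) && simrel a b u (embB t)].

Definition star_rel n (a b : {set {set pt n}}) : rel (pt n) :=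
  fun p q => (p == q) ||
    (simrel a b (embR p) (embR q) && ~~ has_point a b (embR p)).

Definition star n (a b : {set {set pt n}}) : {set {set pt n}} :=
  equivalence_partition (star_rel a b) [set: pt n].

Definition swap n (p : pt n) : pt n :=
  match p with inl x => inr x | inr x => inl x end.

Definition pinv n (a : {set {set pt n}}) : {set {set pt n}} :=
  [set (@swap n) @: B | B : {set pt n} in a].

Definition permPI n (s : {perm 'I_n}) : {set {set pt n}} :=
  [set [set inl x; inr (s x)] | x : 'I_n].

Definition isUnit n (a : {set {set pt n}}) : Prop :=
  exists s : {perm 'I_n}, a = permPI s.

Definition gamma n (i j : 'I_n) : {set {set pt n}} :=
  [set [set inl i; inl j; inr i]; [set inr j]] :|:
  [set [set inl t; inr t] | t in [set~ i] :&: [set~ j]].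

Inductive gen n (A : {set {set pt n}} -> Prop) : {set {set pt n}} -> Prop :=
| gen_base x : A x -> gen A x
| gen_mul x y : gen A x -> gen A y -> gen A (star x y)
| gen_inv x : gen A x -> gen A (pinv x).

Definition generates n (A : {set {set pt n}} -> Prop) : Prop :=
  forall x, isPI x -> gen A x.

(* Main.v *)
Require Import Defs.
From mathcomp Require Import all_boot perm.
Set Implicit Arguments. Unset Strict Implicit. Unset Printing Implicit Defensive.

(* An element whose lines have singleton right-hand sides is a partial map
   [phi f]; permutations and gamma are of this kind. If two points [a], [c] of X
   lie in one line of x, then x is the product of the map folding [a] onto [c]
   (a conjugate of gamma) and of x with [a] made a point; on the X' side use the
   inverse. This reduces (1) to partial injections, which are products of a
   permutation and of conjugates of the idempotent gamma^-1 gamma.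
   For (2), three families are closed under product and inverse, contain the
   permutations and do not contain gamma: the elements without points, the
   partial injections, and the permutations together with the elements of rank at
   most n - 2. So u avoids all three, and counting lines shows that u, or its
   inverse, is a total map onto X minus one element: a two-sided translate of gamma. *)


(** * Partitions as equivalence relations *)

Definition same n (a : {set {set pt n}}) : rel (pt n) :=
  fun p q => q \in pblock a p.

Lemma sameE n (a : {set {set pt n}}) p q :
  partition a [set: pt n] -> same a p q = (pblock a p == pblock a q).
Proof.
by case/and3P=> /eqP ca ta _; rewrite eq_pblock // ca inE.
Qed.

Lemma same_refl n (a : {set {set pt n}}) p :
  partition a [set: pt n] -> same a p p.
Proof. by move=> pa; rewrite sameE. Qed.

Lemma same_sym n (a : {set {set pt n}}) p q :
  partition a [set: pt n] -> same a p q = same a q p.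
Proof. by move=> pa; rewrite !sameE // eq_sym. Qed.

Lemma same_trans n (a : {set {set pt n}}) p q r :
  partition a [set: pt n] -> same a p q -> same a q r -> same a p r.
Proof. by move=> pa; rewrite !sameE // => /eqP-> . Qed.

Lemma pblock_in n (a : {set {set pt n}}) p :
  partition a [set: pt n] -> pblock a p \in a.
Proof. by case/and3P=> /eqP ca _ _; rewrite pblock_mem // ca inE. Qed.

Lemma block_pblock n (a : {set {set pt n}}) B :
  partition a [set: pt n] -> B \in a -> exists2 p, p \in B & B = pblock a p.
Proof.
case/and3P=> _ ta n0 Ba; have [B0|[p pB]] := set_0Vmem B.
  by case/negP: n0; rewrite -B0.
by exists p; rewrite // (def_pblock ta Ba pB).
Qed.

Lemma pointP n (a : {set {set pt n}}) t : partition a [set: pt n] ->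
  reflect (forall q, same a t q -> q = t) ([set t] \in a).
Proof.
move=> pa; apply: (iffP idP) => [ta q|H].
  have [p /set1P-> tE] := block_pblock pa ta.
  by rewrite /same -tE => /set1P.
suff -> : [set t] = pblock a t by exact: pblock_in.
apply/setP=> q; apply/set1P/idP => [->|/H //]; exact: (same_refl t pa).
Qed.

(** This turns equality of elements into equality of relations, the form in which products and
    inverses are computed below. *)
Lemma partition_eq n (a b : {set {set pt n}}) :
  partition a [set: pt n] -> partition b [set: pt n] ->
  same a =2 same b -> a = b.
Proof.
move=> pa pb E; rewrite -(equivalence_partition_pblock pa).
rewrite -(equivalence_partition_pblock pb).
by apply: eq_imset => p; apply/setP=> q; rewrite !inE -[q \in _]/(same a p q) E.
Qed.

Lemma partition_mk n (R : rel (pt n)) : equivalence_rel R ->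
  partition (equivalence_partition R [set: pt n]) [set: pt n].
Proof. by move=> eR; apply: equivalence_partitionP => x y z *; apply: eR. Qed.

Lemma same_mk n (R : rel (pt n)) : equivalence_rel R ->
  same (equivalence_partition R [set: pt n]) =2 R.
Proof.
move=> eR p q; rewrite /same pblock_equivalence_partition ?inE //.
Qed.

(** A class is determined by any of its points, so it is enough that every listed block is a class
    and that the listed blocks cover. It serves to recognise the explicit block lists of inverses,
    permutations and [gamma]. *)
Lemma eq_mk n (R : rel (pt n)) (c : {set {set pt n}}) : equivalence_rel R ->
  (forall B, B \in c -> exists p, B = [set q | R p q]) ->
  (forall p, exists2 B, B \in c & p \in B) ->
  c = equivalence_partition R [set: pt n].
Proof.
move=> eR H1 H2; apply/setP=> B; apply/idP/imsetP=> [/H1[p ->]|[p _ ->]].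
  by exists p; rewrite ?inE //; apply/setP=> q; rewrite !inE.
have [B' Bc pB'] := H2 p; have [p' B'E] := H1 _ Bc.
suff <- : B' = [set y in [set: pt n] | R p y] by [].
move: pB'; rewrite B'E inE => Rp'p; apply/setP=> q; rewrite !inE.
by have [_ ->] := eR p' p q.
Qed.

(** * The inverse; points and lines *)

Lemma swapK n : involutive (@swap n).
Proof. by case. Qed.

Lemma same_swap_equiv n (a : {set {set pt n}}) : partition a [set: pt n] ->
  equivalence_rel (fun p q => same a (swap p) (swap q)).
Proof.
move=> pa p q r; split; first exact: same_refl.
by rewrite !sameE // => /eqP->.
Qed.

Lemma pinv_mk n (a : {set {set pt n}}) : partition a [set: pt n] ->
  pinv a = equivalence_partition (fun p q => same a (swap p) (swap q)) [set: pt n].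
Proof.
move=> pa; apply: eq_mk; first exact: same_swap_equiv.
  move=> _ /imsetP[B /(block_pblock pa)[p _ BE] ->]; exists (swap p).
  apply/setP=> q; rewrite inE swapK /same -BE; apply/imsetP/idP => [[r rB ->]|qB].
    by rewrite swapK.
  by exists (swap q); rewrite ?swapK.
move=> p; exists (@swap n @: pblock a (swap p)).
  by apply: imset_f; apply: pblock_in.
by apply/imsetP; exists (swap p); rewrite ?swapK //; apply: (same_refl _ pa).
Qed.

Lemma pinv_partition n (a : {set {set pt n}}) :
  partition a [set: pt n] -> partition (pinv a) [set: pt n].
Proof. by move=> pa; rewrite pinv_mk //; apply/partition_mk/same_swap_equiv. Qed.

Lemma same_pinv n (a : {set {set pt n}}) p q : partition a [set: pt n] ->
  same (pinv a) p q = same a (swap p) (swap q).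
Proof. by move=> pa; rewrite pinv_mk // same_mk //; apply: same_swap_equiv. Qed.

Lemma pinvK n (a : {set {set pt n}}) :
  partition a [set: pt n] -> pinv (pinv a) = a.
Proof.
move=> pa; apply: partition_eq => [| //|p q]; first by do 2!apply: pinv_partition.
by rewrite !same_pinv ?swapK //; apply: pinv_partition.
Qed.

Lemma point_pinv n (a : {set {set pt n}}) t : partition a [set: pt n] ->
  ([set t] \in pinv a) = ([set swap t] \in a).
Proof.
move=> pa; have ppa := pinv_partition pa.
apply/(pointP _ ppa)/(pointP _ pa) => H q.
  by move=> sq; rewrite -(H (swap q)) ?swapK // same_pinv // swapK.
by rewrite same_pinv // => /H /(can_inj (@swapK n)).
Qed.

(** A block that is not a point contains two distinct related elements, so membership in the monoid
    can be tested on such pairs instead of on blocks. *)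
Lemma isPI_same n (a : {set {set pt n}}) : partition a [set: pt n] ->
  (forall p q, same a p q -> q != p ->
     (exists i, same a p (inl i)) /\ (exists j, same a p (inr j))) -> isPI a.
Proof.
move=> pa H; split=> // B Ba; have [p _ BE] := block_pblock pa Ba.
have [Bp|/(pointP _ pa)Hn] := boolP ([set p] \in a).
  left; have [q /set1P-> pE] := block_pblock pa Bp.
  by rewrite BE -pE cards1.
right; rewrite BE.
have [/existsP[q /andP[sq nq]]|/existsPn Hq] := boolP [exists q, same a p q && (q != p)].
  exact: H sq nq.
case: Hn => q sq; apply/eqP; move: (Hq q); rewrite sq /=; by rewrite negbK.
Qed.

Lemma isPI_part n (a : {set {set pt n}}) : isPI a -> partition a [set: pt n].
Proof. by case. Qed.

Lemma isPI_line n (a : {set {set pt n}}) p q : isPI a -> same a p q -> q != p ->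
  (exists i, same a p (inl i)) /\ (exists j, same a p (inr j)).
Proof.
move=> [pa H] spq npq; case: (H _ (pblock_in p pa)) => [/eqP/cards1P[r E]|//].
move: spq (same_refl p pa); rewrite /same E => /set1P qr /set1P pr.
by rewrite qr pr eqxx in npq.
Qed.

Lemma isPI_npoint n (a : {set {set pt n}}) p : isPI a -> [set p] \notin a ->
  (exists i, same a p (inl i)) /\ (exists j, same a p (inr j)).
Proof.
move=> Pa Np; have pa := isPI_part Pa.
have [/existsP[q /andP[sq nq]]|/existsPn Hq] := boolP [exists q, same a p q && (q != p)].
  exact: isPI_line sq nq.
case/(pointP _ pa): Np => q sq; apply/eqP; move: (Hq q); rewrite sq /=; by rewrite negbK.
Qed.

Lemma isPI_pinv n (a : {set {set pt n}}) : isPI a -> isPI (pinv a).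
Proof.
move=> Pa; have pa := isPI_part Pa; apply: isPI_same; first exact: pinv_partition.
move=> p q; rewrite same_pinv // => s; rewrite -(inj_eq (can_inj (@swapK n))) => d.
have [[i si] [j sj]] := isPI_line Pa s d.
by split; [exists j | exists i]; rewrite same_pinv.
Qed.

(** * The generated equivalence and the product *)

Lemma genrelP n (a b : {set {set pt n}}) u v :
  partition a [set: pt n] -> partition b [set: pt n] ->
  reflect ((exists p q, [/\ same a p q, u = embA p & v = embA q]) \/
           (exists p q, [/\ same b p q, u = embB p & v = embB q]))
          (genrel a b u v).
Proof.
move=> pa pb; apply: (iffP orP).
  case=> /existsP[B /and3P[Bc /imsetP[p pB ->] /imsetP[q qB ->]]]; [left|right].
    by exists p, q; split; rewrite // /same (def_pblock _ Bc pB) //; case/and3P: pa.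
  by exists p, q; split; rewrite // /same (def_pblock _ Bc pB) //; case/and3P: pb.
case=> [] [p [q [s -> ->]]]; [left|right]; apply/existsP;
 [exists (pblock a p)|exists (pblock b p)]; rewrite !imset_f ?pblock_in //;
 exact: same_refl.
Qed.

Lemma genrel_sym n (a b : {set {set pt n}}) : symmetric (genrel a b).
Proof.
by move=> u v; rewrite /genrel; congr orb; apply: eq_existsb => B;
   rewrite [(u \in _) && _]andbC.
Qed.

Lemma sim_sym n (a b : {set {set pt n}}) : symmetric (simrel a b).
Proof. by apply: sym_connect_sym; apply: genrel_sym. Qed.

Lemma sim_trans n (a b : {set {set pt n}}) : transitive (simrel a b).
Proof. exact: connect_trans. Qed.

Lemma simA n (a b : {set {set pt n}}) p q :
  partition a [set: pt n] -> partition b [set: pt n] ->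
  same a p q -> simrel a b (embA p) (embA q).
Proof.
by move=> pa pb s; apply: connect1; apply/genrelP => //; left; exists p, q.
Qed.

Lemma simB n (a b : {set {set pt n}}) p q :
  partition a [set: pt n] -> partition b [set: pt n] ->
  same b p q -> simrel a b (embB p) (embB q).
Proof.
by move=> pa pb s; apply: connect1; apply/genrelP => //; right; exists p, q.
Qed.

Lemma connect_map (T T' : finType) (e : rel T) (e' : rel T') (h : T -> T') :
  (forall u v, e u v -> connect e' (h u) (h v)) ->
  forall u v, connect e u v -> connect e' (h u) (h v).
Proof.
move=> H u v /connectP[s]; elim: s u => [|w s IH] u /=; first by move=> _ ->.
by case/andP=> /H uw ps vE; apply: connect_trans uw (IH _ ps vE).
Qed.

(** The labels agree along every edge, hence along every path. This is the tool for showing that two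
    vertices are not related in the generated equivalence, whose definition by paths gives only
    positive information directly. *)
Lemma sim_label n (T : Type) (a b : {set {set pt n}}) (l : tri n -> T) :
  partition a [set: pt n] -> partition b [set: pt n] ->
  (forall p q, same a p q -> l (embA p) = l (embA q)) ->
  (forall p q, same b p q -> l (embB p) = l (embB q)) ->
  forall u v, simrel a b u v -> l u = l v.
Proof.
move=> pa pb HA HB u v /connectP[s]; elim: s u => [|w s IH] u /=; first by move=> _ ->.
case/andP=> /(genrelP _ _ pa pb) uw ps vE; rewrite -(IH _ ps vE).
by case: uw => [] [p [q [s1 -> ->]]]; auto.
Qed.

Lemma has_pointP n (a b : {set {set pt n}}) u :
  reflect ((exists2 t, [set t] \in a & simrel a b u (embA t)) \/
           (exists2 t, [set t] \in b & simrel a b u (embB t)))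
          (has_point a b u).
Proof.
apply: (iffP orP).
  by case=> /existsP[t /andP[? ?]]; [left|right]; exists t.
by case=> [] [t ? ?]; [left|right]; apply/existsP; exists t; apply/andP.
Qed.

Lemma has_point_sim n (a b : {set {set pt n}}) u v :
  simrel a b u v -> has_point a b v -> has_point a b u.
Proof.
move=> s /has_pointP[] [t Ht st]; apply/has_pointP; [left|right]; exists t => //;
exact: sim_trans st.
Qed.

Lemma has_point_eq n (a b : {set {set pt n}}) u v :
  simrel a b u v -> has_point a b u = has_point a b v.
Proof.
move=> s; apply/idP/idP; apply: has_point_sim => //; by rewrite sim_sym.
Qed.

(** Containing a point is a property of the whole class, by [has_point_eq], so the condition imposed
    on one end of a pair passes to the other. *)
Lemma star_rel_equiv n (a b : {set {set pt n}}) : equivalence_rel (star_rel a b).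
Proof.
move=> p q r; rewrite /star_rel eqxx; split=> //.
case/orP=> [/eqP->//|/andP[s np]].
have nq : ~~ has_point a b (embR q) by rewrite -(has_point_eq s).
rewrite np nq !andbT.
apply/orP/orP=> [] [/eqP<-|t]; right.
- by rewrite sim_sym.
- by apply: sim_trans t; rewrite sim_sym.
- by [].
exact: sim_trans t.
Qed.

Lemma star_partition n (a b : {set {set pt n}}) : partition (star a b) [set: pt n].
Proof. exact/partition_mk/star_rel_equiv. Qed.

Lemma same_star n (a b : {set {set pt n}}) : same (star a b) =2 star_rel a b.
Proof. exact/same_mk/star_rel_equiv. Qed.

(* Computes a product from a labelling of the three copies: [None] marks the
   classes containing a point. *)
Lemma star_label n (T : eqType) (a b : {set {set pt n}}) (l : tri n -> option T) :
  partition a [set: pt n] -> partition b [set: pt n] ->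
  (forall p q, same a p q -> l (embA p) = l (embA q)) ->
  (forall p q, same b p q -> l (embB p) = l (embB q)) ->
  (forall u v z, l u = Some z -> l v = Some z -> simrel a b u v) ->
  (forall u, l u = None -> has_point a b u) ->
  (forall t, [set t] \in a -> l (embA t) = None) ->
  (forall t, [set t] \in b -> l (embB t) = None) ->
  forall p q, star_rel a b p q =
    (p == q) || ((l (embR p) == l (embR q)) && (l (embR p) != None)).
Proof.
move=> pa pb HA HB Hs Hp PA PB p q; rewrite /star_rel; congr orb.
have sl := sim_label pa pb HA HB.
have hpE u : has_point a b u = (l u == None).
  apply/idP/eqP => [|/Hp//].
  by case/has_pointP=> [] [t /[dup] ? /[swap] /sl->]; auto.
rewrite hpE; case E: (l (embR p)) => [z|]; last by rewrite !andbF.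
rewrite !andbT; apply/idP/eqP => [/sl <-//|E']; exact: Hs E (esym E').
Qed.

(** Start from an element of X whose class contains no point: its block in [a] is a line and reaches
    the middle copy, and the block of [b] met there is again a line and reaches X'. The walk from X'
    is symmetric. *)
Lemma isPI_star n (a b : {set {set pt n}}) : isPI a -> isPI b -> isPI (star a b).
Proof.
move=> Pa Pb; have pa := isPI_part Pa; have pb := isPI_part Pb.
apply: isPI_same; first exact: star_partition.
move=> p q; rewrite same_star /star_rel eq_sym => /orP[-> //|/andP[_ np] _].
case: p np => [i|j] np.
  split; first by exists i; rewrite same_star /star_rel eqxx.
  have ni : [set inl i] \notin a.
    by apply: contra np => s; apply/has_pointP; left; exists (inl i) => //; exact: connect0.
  have [_ [j /(simA pa pb) sj]] := isPI_npoint Pa ni.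
  have nj : [set inl j] \notin b.
    by apply: contra np => s; apply/has_pointP; right; exists (inl j).
  have [_ [k /(simB pa pb) sk]] := isPI_npoint Pb nj.
  exists k; rewrite same_star /star_rel np (sim_trans sj sk) orbT //.
split; last by exists j; rewrite same_star /star_rel eqxx.
have ni : [set inr j] \notin b.
  by apply: contra np => s; apply/has_pointP; right; exists (inr j) => //; exact: connect0.
have [[i /(simB pa pb) si] _] := isPI_npoint Pb ni.
have nj : [set inr i] \notin a.
  by apply: contra np => s; apply/has_pointP; left; exists (inr i).
have [[k /(simA pa pb) sk] _] := isPI_npoint Pa nj.
exists k; rewrite same_star /star_rel np (sim_trans si sk) orbT //.
Qed.

(** * Inversion reverses products *)

Definition tri_rev n (u : tri n) : tri n := (u.1, rev_ord u.2).

Lemma tri_revK n : involutive (@tri_rev n).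
Proof. by case=> x t; rewrite /tri_rev /= rev_ordK. Qed.

Lemma tri_rev_embA n (p : pt n) : tri_rev (embA p) = embB (swap p).
Proof. by case: p => x; congr pair; apply: val_inj. Qed.

Lemma tri_rev_embB n (p : pt n) : tri_rev (embB p) = embA (swap p).
Proof. by case: p => x; congr pair; apply: val_inj. Qed.

Lemma tri_rev_embR n (p : pt n) : tri_rev (embR p) = embR (swap p).
Proof. by case: p => x; congr pair; apply: val_inj. Qed.

(** Reversing the order of the three copies fixes the middle one and carries the blocks of [a] and
    [b] to those of [pinv a] and [pinv b], now in the opposite order. *)
Lemma sim_pinv n (a b : {set {set pt n}}) u v :
  partition a [set: pt n] -> partition b [set: pt n] ->
  simrel a b u v -> simrel (pinv b) (pinv a) (tri_rev u) (tri_rev v).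
Proof.
move=> pa pb; have [pa' pb'] := (pinv_partition pa, pinv_partition pb).
apply: connect_map => {}u {}v /(genrelP _ _ pa pb)[] [p [q [s -> ->]]].
  by rewrite !tri_rev_embA; apply: simB => //; rewrite same_pinv ?swapK.
by rewrite !tri_rev_embB; apply: simA => //; rewrite same_pinv ?swapK.
Qed.

Lemma has_point_pinv n (a b : {set {set pt n}}) u :
  partition a [set: pt n] -> partition b [set: pt n] ->
  has_point a b u -> has_point (pinv b) (pinv a) (tri_rev u).
Proof.
move=> pa pb /has_pointP[] [t Ht /(sim_pinv pa pb)];
  rewrite ?tri_rev_embA ?tri_rev_embB => s; apply/has_pointP; [right|left];
  by exists (swap t); rewrite // point_pinv // swapK.
Qed.

(** Reversal gives one implication for [simrel] and one for [has_point]; the same lemmas applied to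
    the inverses give the converses, since both reversal and inversion are involutions. *)
Lemma pinv_star n (a b : {set {set pt n}}) :
  partition a [set: pt n] -> partition b [set: pt n] ->
  pinv (star a b) = star (pinv b) (pinv a).
Proof.
move=> pa pb; have [pa' pb'] := (pinv_partition pa, pinv_partition pb).
have ps := star_partition a b.
apply: partition_eq; [exact: pinv_partition | exact: star_partition | move=> p q].
rewrite same_pinv // !same_star /star_rel (inj_eq (can_inj (@swapK n))).
rewrite -!tri_rev_embR; congr (_ || (_ && ~~ _)); apply/idP/idP.
- by move/(sim_pinv pa pb); rewrite !tri_revK.
- by move/(sim_pinv pb' pa'); rewrite !pinvK.
- by move/(has_point_pinv pa pb); rewrite !tri_revK.
- by move/(has_point_pinv pb' pa'); rewrite !pinvK.
Qed.


(** * Partial maps, permutations and [gamma] *)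

(* [phi f] has the generalised lines f^-1(y) ∪ {y'}, for y in the image of the
   partial map f. *)
Definition phi_lab n (f : 'I_n -> option 'I_n) (p : pt n) : option 'I_n :=
  match p with
  | inl x => f x
  | inr y => if [exists x, f x == Some y] then Some y else None
  end.

Definition phi_rel n (f : 'I_n -> option 'I_n) : rel (pt n) :=
  fun p q => (p == q) || ((phi_lab f p == phi_lab f q) && (phi_lab f p != None)).

Definition phi n (f : 'I_n -> option 'I_n) : {set {set pt n}} :=
  equivalence_partition (phi_rel f) [set: pt n].

Lemma lab_rel_equiv (U : eqType) (T : eqType) (l : U -> option T) :
  equivalence_rel (fun p q => (p == q) || ((l p == l q) && (l p != None))).
Proof.
move=> p q r; rewrite eqxx; split=> // /orP[/eqP->//|/andP[/eqP E np]].
rewrite -E np !andbT; apply/orP/orP=> [] [/eqP<-|t]; right; by rewrite // -?E ?eqxx.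
Qed.

Lemma phi_partition n (f : 'I_n -> option 'I_n) : partition (phi f) [set: pt n].
Proof. exact/partition_mk/lab_rel_equiv. Qed.

Lemma same_phi n (f : 'I_n -> option 'I_n) : same (phi f) =2 phi_rel f.
Proof. exact/same_mk/lab_rel_equiv. Qed.

Lemma eq_phi n (f g : 'I_n -> option 'I_n) : f =1 g -> phi f = phi g.
Proof.
move=> E; apply: partition_eq; try exact: phi_partition.
have El : phi_lab f =1 phi_lab g.
  by case=> x //=; congr (if _ then _ else _); apply: eq_existsb => y; rewrite E.
by move=> p q; rewrite !same_phi /phi_rel !El.
Qed.

Lemma phi_inr n (f : 'I_n -> option 'I_n) x y :
  f x = Some y -> phi_lab f (inr y) = Some y.
Proof. by move=> E /=; case: existsP => // [[]]; exists x; rewrite E. Qed.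

Lemma phi_inr_ex n (f : 'I_n -> option 'I_n) y z :
  phi_lab f (inr y) = Some z -> y = z /\ exists x, f x = Some y.
Proof. by move=> /=; case: existsP => // [[x /eqP E]] [<-]; split; last exists x. Qed.

Lemma same_phi_line n (f : 'I_n -> option 'I_n) x y :
  f x = Some y -> same (phi f) (inl x) (inr y).
Proof. by move=> E; rewrite same_phi /phi_rel (phi_inr E) /= E eqxx. Qed.

Lemma point_phi n (f : 'I_n -> option 'I_n) t :
  ([set t] \in phi f) = (phi_lab f t == None).
Proof.
have pf := phi_partition f; apply/(pointP _ pf)/eqP => [H|E q].
  case: t H => [x|y] H.
    by case E: (f x) => [y|] //=; have := H _ (same_phi_line E).
  case E: (phi_lab f (inr y)) => [z|] //; have [_ [x fx]] := phi_inr_ex E.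
  by have := same_phi_line fx; rewrite same_sym // => /H.
by rewrite same_phi /phi_rel E eqxx andbF orbF => /eqP.
Qed.

Lemma isPI_phi n (f : 'I_n -> option 'I_n) : isPI (phi f).
Proof.
have pf := phi_partition f; apply: isPI_same => // p q s d.
have /eqP : phi_lab f p != None.
  by rewrite -point_phi; apply/(pointP _ pf) => /(_ q s) E; rewrite E eqxx in d.
case: p {s d} => [x|y].
  case E: (phi_lab f (inl x)) => [y|] // _; split; first by exists x; apply: same_refl.
  by exists y; apply: same_phi_line.
case E: (phi_lab f (inr y)) => [z|] // _; have [_ [x fx]] := phi_inr_ex E.
split; last by exists y; apply: same_refl.
by exists x; rewrite same_sym //; apply: same_phi_line.
Qed.

Lemma same_phi_lab n (f : 'I_n -> option 'I_n) p q :
  same (phi f) p q -> phi_lab f p = phi_lab f q.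
Proof. by rewrite same_phi => /orP[/eqP->|/andP[/eqP]]. Qed.

Lemma pt_eqE n (x y : 'I_n) :
  (((inl x : pt n) == inl y) = (x == y)) * (((inr x : pt n) == inr y) = (x == y)) *
  (((inl x : pt n) == inr y) = false) * (((inr x : pt n) == inl y) = false).
Proof. by do ![split=> //]; apply/eqP/eqP=> [[]|->]. Qed.

Lemma permPI_phi n (s : {perm 'I_n}) : permPI s = phi (fun x => Some (s x)).
Proof.
apply: eq_mk; first exact: lab_rel_equiv.
  move=> B /imsetP[x _ ->]; exists (inl x); apply/setP=> q; rewrite !inE /phi_rel andbT.
  case: q => y; rewrite !pt_eqE ?orbF /=.
    by rewrite (inj_eq Some_inj) (inj_eq perm_inj) eq_sym orbb.
  have -> : [exists x0, Some (s x0) == Some y].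
    by apply/existsP; exists (s^-1 y)%g; rewrite permKV.
  by rewrite (inj_eq Some_inj) eq_sym.
case=> [x|y].
  exists [set inl x; inr (s x)]; first by apply/imsetP; exists x.
  by rewrite !inE eqxx.
exists [set inl (s^-1 y)%g; inr y]; last by rewrite !inE eqxx orbT.
by apply/imsetP; exists (s^-1 y)%g; rewrite ?permKV.
Qed.

(** The total map behind [gamma i j]: its fibre over [i] is the pair of [i] and [j], and [j] has no
    preimage, which produces the point on the right. *)
Definition fold_pt n (i j : 'I_n) (y : 'I_n) : option 'I_n :=
  Some (if y == j then i else y).

Lemma fold_ptP n (i j y : 'I_n) : i != j ->
  [exists x, fold_pt i j x == Some y] = (y != j).
Proof.
move=> ij; apply/existsP/idP => [[x /eqP[<-]]|yj].
  by case: ifP => // ->.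
by exists y; rewrite /fold_pt (negbTE yj).
Qed.

Lemma gamma_phi n (i j : 'I_n) : i != j -> gamma i j = phi (fold_pt i j).
Proof.
move=> ij; apply: eq_mk; first exact: lab_rel_equiv.
  have inrE y : phi_lab (fold_pt i j) (inr y) = if y != j then Some y else None.
    by rewrite /phi_lab fold_ptP.
  have SE (x y : 'I_n) : (Some x == Some y) = (x == y) by apply/eqP/eqP=> [[]|->].
  move=> B; rewrite !inE -orbA => /or3P[/eqP->|/eqP->|/imsetP[t]].
  - exists (inl i); apply/setP=> -[y|y]; rewrite !inE /phi_rel ?inrE !pt_eqE ?orbF /=.
      rewrite /fold_pt (negbTE ij) andbT SE ![i == _]eq_sym.
      by have [->|yj] := eqVneq y j; rewrite ?eqxx ?orbT ?orbF ?orbb.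
    rewrite /fold_pt (negbTE ij) andbT; have [->|yj] /= := eqVneq y j.
      by rewrite eq_sym (negbTE ij).
    by rewrite SE eq_sym.
  - exists (inr j); apply/setP=> -[y|y]; rewrite !inE /phi_rel ?inrE !pt_eqE ?orbF eqxx /=.
      by [].
    by rewrite andbF orbF eq_sym.
  rewrite !inE => /andP[ti tj] ->.
  exists (inl t); apply/setP=> -[y|y]; rewrite !inE /phi_rel ?inrE !pt_eqE ?orbF /=.
    rewrite /fold_pt (negbTE tj) andbT SE ![t == _]eq_sym.
    have [->|yj] := eqVneq y j; last by rewrite orbb.
    by rewrite [i == t]eq_sym [j == t]eq_sym (negbTE ti) (negbTE tj).
  rewrite /fold_pt (negbTE tj) andbT; have [->|yj] /= := eqVneq y j.
    by rewrite eq_sym (negbTE tj).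
  by rewrite SE eq_sym.
have blk t : t != i -> t != j -> [set inl t; inr t] \in gamma i j.
  by move=> ti tj; rewrite inE; apply/orP; right; apply: imset_f; rewrite !inE ti.
have b1 : [set inl i; inl j; inr i] \in gamma i j by rewrite !inE eqxx.
have b2 : [set inr j] \in gamma i j by rewrite !inE eqxx orbT.
case=> y; have [yi|yi] := eqVneq y i; rewrite ?yi.
- by exists [set inl i; inl j; inr i]; rewrite // !inE eqxx.
- have [->|yj] := eqVneq y j.
    by exists [set inl i; inl j; inr i]; rewrite // !inE eqxx orbT.
  by exists [set inl y; inr y]; rewrite ?blk // !inE eqxx.
- by exists [set inl i; inl j; inr i]; rewrite // !inE eqxx !orbT.
have [->|yj] := eqVneq y j; first by exists [set inr j]; rewrite // !inE eqxx.
by exists [set inl y; inr y]; rewrite ?blk // !inE eqxx orbT.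
Qed.

(** * Products of partial maps *)

(** Presents each vertex as the image of an element of one of the two factors, the middle copy
    through the right one, so that the formulas for labels along [embA] and [embB] apply. *)
Variant tri_spec n : tri n -> Type :=
| TriLeft x : tri_spec (embA (inl x))
| TriMid x : tri_spec (embB (inl x))
| TriRight x : tri_spec (embB (inr x)).

Lemma triP n (u : tri n) : tri_spec u.
Proof.
case: u => x [[|[|[|//]]] k].
- have -> : Ordinal k = t0 by apply: val_inj.
  exact: TriLeft.
- have -> : Ordinal k = t1 by apply: val_inj.
  exact: TriMid.
have -> : Ordinal k = t2 by apply: val_inj.
exact: TriRight.
Qed.

Lemma phi_inr_none n (f : 'I_n -> option 'I_n) x y :
  phi_lab f (inr y) = None -> f x <> Some y.
Proof. by move=> E /phi_inr; rewrite E. Qed.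

Lemma phi_inr_total n (f : 'I_n -> option 'I_n) y :
  (exists x, f x = Some y) \/ phi_lab f (inr y) = None.
Proof.
case E: (phi_lab f (inr y)) => [z|]; [left | by right].
by case: (phi_inr_ex E).
Qed.

(* The hypothesis says that no line of the product is lost to a point in the middle. *)
Lemma star_phi n (f g : 'I_n -> option 'I_n) :
  (forall x y z y', f x = Some y -> g y = Some z -> g y' = Some z ->
     exists x', f x' = Some y') ->
  star (phi f) (phi g) = phi (fun x => obind g (f x)).
Proof.
move=> cond; set h := fun x => _.
have pf := phi_partition f; have pg := phi_partition g.
have hE x z : h x = Some z -> exists2 y, f x = Some y & g y = Some z.
  by rewrite /h; case: (f x) => //= y; exists y.
(* The label of a vertex is the point of X' that its line reaches in the product. Filtering by [r]
   discards those points of X' that no element of X reaches. *)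
pose r z := phi_lab h (inr z).
pose l (u : tri n) : option 'I_n :=
  if u.2 == t0 then h u.1 else if u.2 == t1 then obind r (g u.1) else r u.1.
have lA p : l (embA p) = obind (obind r \o g) (phi_lab f p).
  case: p => [x|y]; rewrite /l /=.
    case fx: (f x) => [y|] /=; last by rewrite /h fx.
    case gy: (g y) => [z|] /=; last by rewrite /h fx.
    have hx : h x = Some z by rewrite /h fx.
    by rewrite hx; symmetry; apply: phi_inr hx.
  have [[x fx]|E] := phi_inr_total f y; first by move: (phi_inr fx) => /= ->.
  move: (E) => /= ->; case gy: (g y) => [z|] //=.
  have [[x /hE[y' fx gy']]|//] := phi_inr_total h z.
  (* A middle point outside the image of [f], lying on a line of [g] that the composite does use,
     would break that line; [cond] excludes it. *)
  by have [x' /(phi_inr_none E)] := cond _ _ _ _ fx gy' gy.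
have lB p : l (embB p) = obind r (phi_lab g p).
  case: p => [//|z]; rewrite /l /=.
  have [[y gy]|E] := phi_inr_total g z; first by move: (phi_inr gy) => /= ->.
  move: (E) => /= ->.
  by have [[x /hE[y _ /(phi_inr_none E)]]|] := phi_inr_total h z.
have lR p : l (embR p) = phi_lab h p by case: p.
apply: partition_eq; [exact: star_partition | exact: phi_partition | move=> p q].
rewrite same_star same_phi /phi_rel -!lR.
apply: (star_label (l := l)) => //.
- by move=> {}p {}q /same_phi_lab E; rewrite !lA E.
- by move=> {}p {}q /same_phi_lab E; rewrite !lB E.
(* Equal labels imply relatedness because every labelled vertex is joined to the vertex of X' that
   its label names. *)
- have H u z : l u = Some z -> simrel (phi f) (phi g) u (embB (inr z)).
    case: (triP u) => x.
    + case/hE=> y fx gy; apply: sim_trans (simB pf pg (same_phi_line gy)).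
      exact: simA (same_phi_line fx).
    + rewrite lB /=; case gx: (g x) => [z'|] //= /phi_inr_ex[<- _].
      exact: simB (same_phi_line gx).
    by case/phi_inr_ex=> <- _; apply: connect0.
  by move=> u v z /H su /H sv; apply: sim_trans su _; rewrite sim_sym.
- have midf y : phi_lab f (inr y) = None -> has_point (phi f) (phi g) (embB (inl y)).
    move=> E; apply/has_pointP; left; exists (inr y); last exact: connect0.
    by rewrite point_phi E.
  have midg y : g y = None -> has_point (phi f) (phi g) (embB (inl y)).
    move=> E; apply/has_pointP; right; exists (inl y); last exact: connect0.
    by rewrite point_phi /= E.
  move=> u; case: (triP u) => x.
  + rewrite lA /=; case fx: (f x) => [y|] /=.
      case gy: (g y) => [z|] /=.
        by move/(phi_inr_none (x := x)); rewrite /h fx /= gy.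
      move=> _; apply: has_point_sim (midg _ gy).
      exact: simA (same_phi_line fx).
    move=> _; apply/has_pointP; left; exists (inl x); last exact: connect0.
    by rewrite point_phi /= fx.
  + rewrite lB /=; case gx: (g x) => [z|] /=; last by move=> _; apply: midg.
    move=> rz; have [[x' fx']|] := phi_inr_total f x; last exact: midf.
    by case: (phi_inr_none (x := x') rz); rewrite /h fx'.
  move=> rx; have [[y gy]|E] := phi_inr_total g x.
    apply: (has_point_sim (v := embB (inl y))).
      by rewrite sim_sym; exact: simB (same_phi_line gy).
    apply: midf; have [[x' fx']|//] := phi_inr_total f y.
    by case: (phi_inr_none (x := x') rx); rewrite /h fx'.
  apply/has_pointP; right; exists (inr x); last exact: connect0.
  by rewrite point_phi E.
- by move=> t; rewrite point_phi => /eqP E; rewrite lA E.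
- by move=> t; rewrite point_phi => /eqP E; rewrite lB E.
Qed.

(** The two copies of each line of [phi f] are glued along its whole fibre, so the product is the
    partial identity on the image of [f]. This is computed directly, because [pinv (phi f)] is in
    general not given by a partial map. *)
Lemma star_pinv_phi n (f : 'I_n -> option 'I_n) :
  star (pinv (phi f)) (phi f) = phi (fun y => phi_lab f (inr y)).
Proof.
have pf := phi_partition f; have pf' := pinv_partition pf.
(* The middle copy is the domain of [f], and both outer copies are its codomain. *)
pose l (u : tri n) := phi_lab f (if u.2 == t1 then inl u.1 else inr u.1).
have lA p : l (embA p) = phi_lab f (swap p) by case: p.
have lB p : l (embB p) = phi_lab f p by case: p.
have lR p : l (embR p) = phi_lab (fun y => phi_lab f (inr y)) p.
  case: p => // y; have [[x fx]|E] := phi_inr_total f y.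
    have fy := phi_inr fx; by rewrite (phi_inr fy).
  have [[x /phi_inr_ex[-> [x' /(phi_inr_none E)]]] //|->] :=
    phi_inr_total (fun y => phi_lab f (inr y)) y.
  by [].
apply: partition_eq; [exact: star_partition | exact: phi_partition | move=> p q].
rewrite same_star same_phi /phi_rel -!lR.
apply: (star_label (l := l)) => //.
- by move=> {}p {}q; rewrite same_pinv // => /same_phi_lab E; rewrite !lA E.
- by move=> {}p {}q /same_phi_lab E; rewrite !lB E.
- have H u z : l u = Some z -> simrel (pinv (phi f)) (phi f) u (embB (inr z)).
    case: (triP u) => x.
    + case/phi_inr_ex=> <- [y fy].
      apply: sim_trans (simB pf' pf (same_phi_line fy)).
      apply: (@simA _ _ _ (inl x) (inr y)) => //.
      by rewrite same_pinv // same_sym //; apply: same_phi_line.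
    + by move=> fx; apply: simB (same_phi_line fx).
    by case/phi_inr_ex=> <- _; apply: connect0.
  by move=> u v z /H su /H sv; apply: sim_trans su _; rewrite sim_sym.
- move=> u; case: (triP u) => x E; apply/has_pointP.
  + left; exists (inl x); last exact: connect0.
    by rewrite point_pinv // point_phi; apply/eqP.
  + right; exists (inl x); last exact: connect0.
    by rewrite point_phi; apply/eqP.
  right; exists (inr x); last exact: connect0.
  by rewrite point_phi; apply/eqP.
- by move=> t; rewrite point_pinv // point_phi => /eqP E; rewrite lA E.
- by move=> t; rewrite point_phi => /eqP E; rewrite lB E.
Qed.

(** * Left factors: permutations and folds *)

(* The blocks of [x], all points being identified. *)
Definition line_lab n (x : {set {set pt n}}) (p : pt n) : option {set pt n} :=
  if [set p] \in x then None else Some (pblock x p).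

Lemma line_lab_same n (x : {set {set pt n}}) p q :
  partition x [set: pt n] -> same x p q -> line_lab x p = line_lab x q.
Proof.
move=> px s; rewrite /line_lab; move: (s); rewrite sameE // => /eqP <-.
congr (if _ then _ else _); apply/idP/idP => /[dup] ? /(pointP _ px) H.
  by have -> : q = p by apply: H.
by have -> : p = q by apply: H; rewrite same_sym.
Qed.

Lemma line_labE n (x : {set {set pt n}}) p q : partition x [set: pt n] ->
  same x p q = (p == q) ||
    ((line_lab x p == line_lab x q) && (line_lab x p != None)).
Proof.
move=> px; apply/idP/idP => [s|/orP[/eqP->|]]; last 2 first.
- exact: same_refl.
- rewrite /line_lab; case: ifP => // _; case: ifP => // _; rewrite andbT.
  by rewrite sameE // => /eqP[->].
rewrite (line_lab_same px s) eqxx /line_lab; case: ifP => /= [/(pointP _ px) H|].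
  by rewrite (H p) ?eqxx // same_sym.
by rewrite orbT.
Qed.

(** A permutation has no points, so it destroys no line and only renames X. The right factor is
    arbitrary here, since [pinv gamma] must be covered too. *)
Lemma same_star_perm n (s : {perm 'I_n}) (x : {set {set pt n}}) p q :
  let L r := match r with inl i => inl (s i) | inr j => inr j end in
  partition x [set: pt n] -> same (star (permPI s) x) p q = same x (L p) (L q).
Proof.
move=> L px; have ps : partition (permPI s) [set: pt n].
  by rewrite permPI_phi; apply: phi_partition.
pose l (u : tri n) := line_lab x
  (if u.2 == t0 then inl (s u.1) else if u.2 == t1 then inl u.1 else inr u.1).
have lB r : l (embB r) = line_lab x r by case: r.
have labs y : phi_lab (fun i => Some (s i)) (inr y) = Some y.
  by apply: (@phi_inr _ _ (s^-1 y)%g); rewrite permKV.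
have lA r : Some (l (embA r)) =
    omap (fun z => line_lab x (inl z)) (phi_lab (fun i => Some (s i)) r).
  by case: r => i; rewrite ?labs.
have lR r : l (embR r) = line_lab x (L r) by case: r.
have Linj : injective L.
  by move=> [i|i] [j|j] // [E]; congr (_ _); rewrite // (perm_inj E).
have rep u : exists2 r, l u = line_lab x r & simrel (permPI s) x u (embB r).
  case: (triP u) => i; last 2 first.
  - by exists (inl i) => //; apply: connect0.
  - by exists (inr i) => //; apply: connect0.
  exists (inl (s i)) => //; apply: (@simA _ _ _ (inl i) (inr (s i))) => //.
  by rewrite permPI_phi; apply: same_phi_line.
rewrite same_star line_labE // (inj_eq Linj) -!lR.
apply: (star_label (l := l)) => //.
- move=> {}p {}q; rewrite permPI_phi => /same_phi_lab E.
  by apply: Some_inj; rewrite !lA E.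
- by move=> {}p {}q sx; rewrite !lB; apply: line_lab_same.
- move=> u v z; have [p' -> su] := rep u; have [q' -> sv] := rep v => Ep Eq.
  apply: sim_trans su _; rewrite sim_sym; apply: sim_trans sv _; apply: simB => //.
  by rewrite line_labE // Ep Eq eqxx orbT.
- move=> u; have [r -> su] := rep u; rewrite /line_lab; case: ifP => // xr _.
  by apply/has_pointP; right; exists r.
- by move=> t; rewrite permPI_phi point_phi; case: t => // y; rewrite labs.
- by move=> t xt; rewrite lB /line_lab xt.
Qed.

Definition cut_rel n (x : {set {set pt n}}) (p : pt n) : rel (pt n) :=
  fun q r => (q == r) || [&& q != p, r != p & same x q r].

Definition cut n (x : {set {set pt n}}) (p : pt n) : {set {set pt n}} :=
  equivalence_partition (cut_rel x p) [set: pt n].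

Lemma cut_rel_equiv n (x : {set {set pt n}}) p :
  partition x [set: pt n] -> equivalence_rel (cut_rel x p).
Proof.
move=> px q r s; rewrite /cut_rel eqxx; split=> // /orP[/eqP->//|/and3P[qp rp sqr]].
apply/orP/orP=> [] [/eqP<-|/and3P[ap sp t]]; right.
- by rewrite rp qp same_sym.
- by rewrite rp sp; apply: same_trans t; rewrite // same_sym.
- by rewrite qp rp.
by rewrite qp sp; apply: same_trans t.
Qed.

Lemma same_cut n (x : {set {set pt n}}) p : partition x [set: pt n] ->
  same (cut x p) =2 cut_rel x p.
Proof. by move=> px; apply/same_mk/cut_rel_equiv. Qed.

Lemma cut_partition n (x : {set {set pt n}}) p : partition x [set: pt n] ->
  partition (cut x p) [set: pt n].
Proof. by move=> px; apply/partition_mk/cut_rel_equiv. Qed.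

(** When [a] is taken off its line, [c] stays behind as an element of X on that line. *)
Lemma isPI_cut n (x : {set {set pt n}}) a c : isPI x -> a != c ->
  same x (inl a) (inl c) -> isPI (cut x (inl a)).
Proof.
move=> Px ac sac; have px := isPI_part Px.
apply: isPI_same => [|p q]; first exact: cut_partition.
rewrite same_cut // /cut_rel eq_sym => /orP[->//|/and3P[pa qa s]] d.
have [[i si] [j sj]] := isPI_line Px s d.
split; last by exists j; rewrite same_cut // /cut_rel pa pt_eqE sj orbT.
have [ia|ia] := eqVneq i a; last first.
  by exists i; rewrite same_cut // /cut_rel pa pt_eqE ia si orbT.
exists c; rewrite same_cut // /cut_rel pa pt_eqE [c == a]eq_sym ac /=.
by rewrite (same_trans px si) ?orbT // ia.
Qed.

(** In the middle copy [a] is a point of both factors, hence isolated. The fold sends the outer [a]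
    to the middle [c], which lies on the old line of [a], so the cut is repaired. *)
Lemma star_fold_cut n (x : {set {set pt n}}) a c : isPI x -> a != c ->
  same x (inl a) (inl c) -> star (phi (fold_pt c a)) (cut x (inl a)) = x.
Proof.
move=> Px ac sac; have px := isPI_part Px; have pc := cut_partition (inl a) px.
have ca : c != a by rewrite eq_sym.
have pf := phi_partition (fold_pt c a).
pose lab := line_lab x.
have lab_same p q : same x p q -> lab p = lab q by exact: line_lab_same.
have sameL p q : same x p q = (p == q) || ((lab p == lab q) && (lab p != None))
  by exact: line_labE.
have pcut t : ([set t] \in cut x (inl a)) = (t == inl a) || ([set t] \in x).
  apply/(pointP _ pc)/orP => [H|[/eqP->|/(pointP _ px) H] q].
  - have [|ta] := eqVneq t (inl a); [by left | right].
    apply/(pointP _ px) => q s; have [qa|qa] := eqVneq q (inl a); last first.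
      by apply: H; rewrite same_cut // /cut_rel ta qa s orbT.
    (* A further singleton could only be left over from the line of [a]; but that line still
       contains both [c] and an element of X', and [t] cannot equal both. *)
    move: s; rewrite qa => s; have s' := same_trans px s sac.
    have tc : inl c = t by apply: H; rewrite same_cut // /cut_rel ta pt_eqE ca s' orbT.
    have [_ [j sj]] := isPI_line Px s (contra_neq esym ta).
    have : inr j = t by apply: H; rewrite same_cut // /cut_rel ta pt_eqE sj orbT.
    by rewrite -tc.
  - by rewrite same_cut // /cut_rel eqxx /= orbF => /eqP.
  by rewrite same_cut // /cut_rel => /orP[/eqP->//|/and3P[_ _ /H]].
have labpt t : lab t = None -> t != inl a -> [set t] \in cut x (inl a).
  by rewrite pcut /lab /line_lab; case: ifP; rewrite ?orbT.
(* Vertices are labelled by lines of [x], except that the isolated middle copy of [a] gets no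
   label. *)
pose l (u : tri n) := if u.2 == t0 then lab (inl u.1)
  else if u.2 == t1 then if u.1 == a then None else lab (inl u.1)
  else lab (inr u.1).
have lB p : l (embB p) = if p == inl a then None else lab p.
  by case: p => y; rewrite /l /= ?pt_eqE.
have lA p : l (embA p) = obind (fun z => lab (inl z)) (phi_lab (fold_pt c a) p).
  case: p => y; rewrite /l /=; last by rewrite fold_ptP //; case: eqVneq.
  by case: eqVneq => // ->; apply: lab_same.
have lR p : l (embR p) = lab p by case: p.
have foldE y : y != a -> fold_pt c a y = Some y by rewrite /fold_pt => /negbTE->.
have neqa y : y != a -> (inl y : pt n) != inl a by rewrite pt_eqE.
have mid y : y != a -> simrel (phi (fold_pt c a)) (cut x (inl a))
                          (embA (inl y)) (embB (inl y)).
  by move=> ya; apply: (simA pf pc (same_phi_line (foldE _ ya))).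
have mida : simrel (phi (fold_pt c a)) (cut x (inl a)) (embA (inl a)) (embB (inl c)).
  by apply: (@simA _ _ _ (inl a) (inr c)) => //; apply: same_phi_line; rewrite /fold_pt eqxx.
apply: partition_eq => [| //|p q]; first exact: star_partition.
rewrite same_star sameL -!lR.
apply: (star_label (l := l)) => //.
- by move=> {}p {}q /same_phi_lab E; rewrite !lA E.
- move=> {}p {}q; rewrite same_cut // /cut_rel => /orP[/eqP->//|/and3P[pa qa s]].
  by rewrite !lB (negbTE pa) (negbTE qa); apply: lab_same.
(* Every labelled vertex is joined to an element of the right factor with the same label and
   different from [a]; for the outer copy of [a] this element is [c]. *)
- have H u z : l u = Some z -> exists2 q', lab q' = Some z & q' != inl a /\ simrel (phi (fold_pt c a)) (cut x (inl a)) u (embB q').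
    case: (triP u) => y.
    + have [->|ya] := eqVneq y a => E.
        by exists (inl c); [rewrite -(lab_same _ _ sac)|rewrite neqa].
      by exists (inl y); rewrite // neqa //; split=> //; apply: mid.
    + rewrite lB; case: eqP => // /eqP ya E; exists (inl y); rewrite // ya.
      by split=> //; apply: connect0.
    by move=> E; exists (inr y) => //; split=> //; apply: connect0.
  move=> u v z /H[p' lp' [p'a su]] /H[q' lq' [q'a sv]].
  apply: sim_trans su _; rewrite sim_sym; apply: sim_trans sv _.
  by apply: simB; rewrite // same_cut // /cut_rel q'a p'a sameL lp' lq' eqxx /= !orbT.
- move=> u; case: (triP u) => y.
  + have [->|ya] := eqVneq y a => E; last first.
      apply: has_point_sim (mid _ ya) _; apply/has_pointP; right.
      by exists (inl y); [apply: labpt; rewrite // neqa | apply: connect0].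
    apply: has_point_sim mida _; apply/has_pointP; right.
    exists (inl c); last exact: connect0.
    by apply: labpt; [rewrite -(lab_same _ _ sac) | rewrite neqa].
  + rewrite lB => E; apply/has_pointP; right; exists (inl y); last exact: connect0.
    by move: E; case: eqP => [-> _|/eqP ya E]; [rewrite pcut eqxx | apply: labpt].
  move=> E; apply/has_pointP; right; exists (inr y); last exact: connect0.
  exact: labpt.
- by move=> t; rewrite point_phi => /eqP E; rewrite lA E.
- move=> t; rewrite pcut lB; case: eqP => //= _; by rewrite /lab /line_lab => ->.
Qed.


(** * Generation from the permutations and [gamma] *)

Definition pinj n (f : 'I_n -> option 'I_n) : Prop :=
  forall x y z, f x = Some z -> f y = Some z -> x = y.

(** When [g] is injective, the only [y'] that the hypothesis of [star_phi] speaks of is [y]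
    itself. *)
Lemma star_phi_pinj n (f g : 'I_n -> option 'I_n) :
  pinj g -> star (phi f) (phi g) = phi (fun x => obind g (f x)).
Proof.
by move=> ig; apply: star_phi => x y z y' fx gy gy'; exists x; rewrite (ig _ _ _ gy' gy).
Qed.

Lemma pinj_perm n (s : {perm 'I_n}) : pinj (fun x => Some (s x)).
Proof. by move=> x y z [<-] [/perm_inj]. Qed.

Lemma star_phi_perm n (f : 'I_n -> option 'I_n) (s : {perm 'I_n}) :
  star (phi f) (permPI s) = phi (fun x => omap s (f x)).
Proof.
by rewrite permPI_phi star_phi_pinj; [apply: eq_phi => x; case: (f x)|exact: pinj_perm].
Qed.

Lemma star_perm_phi n (s : {perm 'I_n}) (f : 'I_n -> option 'I_n) :
  star (permPI s) (phi f) = phi (fun x => f (s x)).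
Proof.
rewrite permPI_phi star_phi // => x y z y' _ _ _.
by exists (s^-1 y')%g; rewrite permKV.
Qed.

Lemma pinv_permPI n (s : {perm 'I_n}) : pinv (permPI s) = permPI s^-1%g.
Proof.
have ps := phi_partition (fun x => Some (s x)).
rewrite !permPI_phi; apply: partition_eq; [exact: pinv_partition|exact: phi_partition|].
have lE (t : {perm 'I_n}) y : phi_lab (fun x => Some (t x)) (inr y) = Some y.
  by apply: (@phi_inr _ _ (t^-1 y)%g); rewrite permKV.
have SE (x y : 'I_n) : (Some x == Some y) = (x == y) by apply/eqP/eqP=> [[]|->].
move=> p q; rewrite same_pinv // !same_phi /phi_rel (inj_eq (can_inj (@swapK n))).
case: p q => x [] y; congr orb; rewrite !lE !andbT !SE.
- by rewrite (inj_eq perm_inj).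
- by apply/eqP/eqP=> [->|<-]; rewrite ?permK ?permKV.
- by apply/eqP/eqP=> [<-|->]; rewrite ?permK ?permKV.
by rewrite (inj_eq perm_inj).
Qed.

Lemma perm_two n (a c a' c' : 'I_n) : a != c -> a' != c' ->
  exists s : {perm 'I_n}, s a = a' /\ s c = c'.
Proof.
(* The first transposition moves [a] to its target; the second corrects the image of [c] and fixes
   that target. *)
move=> ac ac'; exists (tperm a a' * tperm (tperm a a' c) c')%g.
rewrite !permM tpermL [tperm _ c' (tperm _ _ c)]tpermL; split=> //.
apply: tpermD; last by rewrite eq_sym.
by rewrite -{2}(tpermL a a') (inj_eq perm_inj) eq_sym.
Qed.

Lemma gen_fold n (A : {set {set pt n}} -> Prop) (i1 i2 c a : 'I_n) :
  i1 != i2 -> (forall s, gen A (permPI s)) -> gen A (gamma i1 i2) ->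
  c != a -> gen A (phi (fold_pt c a)).
Proof.
move=> i12 U G ca; have [s [sc sa]] := perm_two ca i12.
have -> : phi (fold_pt c a) = star (star (permPI s) (gamma i1 i2)) (permPI s^-1%g).
  rewrite gamma_phi // star_perm_phi star_phi_perm; apply: eq_phi => x.
  by rewrite /fold_pt /= -sa (inj_eq perm_inj) -sc; case: ifP; rewrite permK.
by do 2?apply: gen_mul.
Qed.

(** The fold of [a] onto any other element misses exactly [a], so its inverse times itself is the
    identity off [a]. *)
Lemma gen_pid n (A : {set {set pt n}} -> Prop) (i1 i2 a : 'I_n) :
  i1 != i2 -> (forall s, gen A (permPI s)) -> gen A (gamma i1 i2) ->
  gen A (phi (fun y => if y == a then None else Some y)).
Proof.
move=> i12 U G; have [c ca] : exists c, c != a.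
  have [<-|] := eqVneq i1 a; last by exists i1.
  by exists i2; rewrite eq_sym.
have gf := gen_fold i12 U G ca; have := gen_mul (gen_inv gf) gf.
rewrite star_pinv_phi; congr gen; apply: eq_phi => y.
by rewrite /= fold_ptP //; case: eqVneq.
Qed.

(** Induction on the number of undefined elements. A total partial injection is a permutation.
    Otherwise [f] is undefined at some [a] and misses some [b]; it is then the identity off [a]
    followed by the extension of [f] that sends [a] to [b]. *)
Lemma gen_pinj n (A : {set {set pt n}} -> Prop) (i1 i2 : 'I_n) f :
  i1 != i2 -> (forall s, gen A (permPI s)) -> gen A (gamma i1 i2) ->
  pinj f -> gen A (phi f).
Proof.
move=> i12 U G; have [m le_m] := ubnP #|[set x | f x == None]|.
elim: m f le_m => // m IH f le_m inf.
have [/existsP[a /eqP fa]|/existsPn tot] := boolP [exists a, f a == None]; last first.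
  have fE x : f x = Some (odflt x (f x)) by move: (tot x); case: (f x).
  have inj_g : injective (fun x => odflt x (f x)).
    by move=> x y E; apply: (inf _ _ _ (fE x)); rewrite E -fE.
  have -> : phi f = permPI (perm inj_g).
    by rewrite permPI_phi; apply: eq_phi => x; rewrite permE -fE.
  exact: U.
have [b fb] : exists b, forall x, f x <> Some b.
  (* Pigeonhole: if [f] took every value besides [None], its image would have n + 1 elements. *)
  have [/forallP H|/forallPn[b Hb]] := boolP [forall b, [exists x, f x == Some b]].
    have : #|{: option 'I_n}| <= #|'I_n|.
      apply: leq_trans (leq_image_card f _); apply: subset_leq_card.
      apply/subsetP => -[b|] _; last by rewrite -fa codom_f.
      by have /existsP[x /eqP <-] := H b; apply: codom_f.
    by rewrite card_option ltnn.
  by exists b => x fx; case/existsP: Hb; exists x; apply/eqP.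
pose f' x := if x == a then Some b else f x.
have inf' : pinj f'.
  move=> x y z; rewrite /f'; case: eqP => [->|_]; case: eqP => [->|_] //.
  - by move=> [<-] /fb.
  - by move=> + [zb]; rewrite -zb => /fb.
  exact: inf.
have -> : phi f = star (phi (fun y => if y == a then None else Some y)) (phi f').
  rewrite star_phi_pinj //; apply: eq_phi => x; rewrite /f'.
  by case E: (x == a); rewrite /= ?E // (eqP E).
apply: gen_mul; first exact: gen_pid i12 U G.
apply: IH => //; rewrite -ltnS; apply: leq_trans le_m; rewrite ltnS.
apply: proper_card; apply/properP; split.
  by apply/subsetP=> x; rewrite !inE /f'; case: (x =P a).
by exists a; rewrite !inE /f' ?fa ?eqxx.
Qed.

(** If no line contains two elements of X', each element of X on a line determines its partner
    there, so the choice made by [pick] is forced. *)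
Lemma isPI_phi_pick n (x : {set {set pt n}}) : isPI x ->
  (forall j k, same x (inr j) (inr k) -> j = k) ->
  exists2 f, x = phi f & forall i j, f i = Some j -> same x (inl i) (inr j).
Proof.
move=> Px ri; have px := isPI_part Px.
pose f i := [pick j | same x (inl i) (inr j)].
have fE i j : f i = Some j -> same x (inl i) (inr j).
  by rewrite /f; case: pickP => // k sk [<-].
have fS i j : same x (inl i) (inr j) -> f i = Some j.
  rewrite /f => s; case: pickP => [k sk|/(_ j)]; last by rewrite s.
  congr Some; apply: ri; apply: same_trans s; by rewrite // same_sym.
exists f => //; have pf := phi_partition f.
have labS p y : phi_lab f p = Some y -> same x p (inr y).
  by case: p => [i /fE //|j /phi_inr_ex[<- _]]; apply: same_refl.
have labN p : phi_lab f p = None -> [set p] \in x.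
  move=> E; apply: contraT => /(isPI_npoint Px)[[i si] [j sj]].
  case: p E si sj => [i' E _ /fS sj|j' E si _]; first by rewrite /= sj in E.
  by case: (phi_inr_none (x := i) E); apply: fS; rewrite same_sym.
apply: partition_eq => // p q; rewrite same_phi /phi_rel.
apply/idP/orP => [s|[/eqP->|/andP[/eqP E]]]; last 2 first.
- exact: same_refl.
- move: E; case: (phi_lab f p) (labS p) => // y /(_ _ erefl) sp /esym /labS sq _.
  by apply: same_trans sp _; rewrite // same_sym.
case Ep: (phi_lab f p) => [y|]; last first.
  by left; move/labN/(pointP _ px)/(_ _ s): Ep => ->.
case Eq: (phi_lab f q) => [z|]; last first.
  by left; move/labN/(pointP _ px): Eq => /(_ p) -> //; rewrite same_sym.
right; rewrite andbT; apply/eqP; congr Some; apply: ri.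
apply: (same_trans (q := p)) => //; first by rewrite same_sym // labS.
by apply: same_trans s _ => //; apply: labS.
Qed.

(** Induction on the number [m] of related ordered pairs. Cutting [a] off a line through [c] loses
    the pair of [a] and [c], and inversion preserves [m], so the same step serves both sides. When
    neither side has a coincidence left, the element is a partial injection. *)
Lemma generates_gamma n (A : {set {set pt n}} -> Prop) (i1 i2 : 'I_n) :
  i1 != i2 -> (forall s, gen A (permPI s)) -> gen A (gamma i1 i2) -> generates A.
Proof.
move=> i12 U G x Px; pose m (x : {set {set pt n}}) := #|[set u | same x u.1 u.2]|.
have m_pinv y : partition y [set: pt n] -> m (pinv y) = m y.
  move=> py; pose sw (u : pt n * pt n) := (swap u.1, swap u.2).
  have sw_inj : injective sw by apply: (can_inj (g := sw)) => -[p q]; rewrite /sw /= !swapK.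
  rewrite /m -(card_preimset [set u | same y u.1 u.2] sw_inj); apply: eq_card => u.
  by rewrite !inE same_pinv.
have m_cut y a c : isPI y -> a != c -> same y (inl a) (inl c) -> m (cut y (inl a)) < m y.
  move=> Py ac s; have py := isPI_part Py; apply: proper_card; apply/properP; split.
    apply/subsetP=> u; rewrite !inE same_cut // => /orP[/eqP->|/and3P[_ _ //]].
    exact: same_refl.
  exists (inl a, inl c); rewrite !inE // same_cut // /cut_rel /= pt_eqE eqxx.
  by rewrite (negbTE ac).
have [k] := ubnP (m x); elim: k x Px => // k IH x Px le_k.
have px := isPI_part Px.
have step y : isPI y -> m y < k.+1 ->
    forall a c, a != c -> same y (inl a) (inl c) -> gen A y.
  move=> Py yk a c ac s; rewrite -(star_fold_cut Py ac s); apply: gen_mul.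
    by apply: gen_fold i12 U G _; rewrite eq_sym.
  apply: IH; first exact: isPI_cut s.
  by apply: leq_trans (m_cut _ _ _ Py ac s) _.
have [/existsP[a /existsP[c /andP[ac s]]]|/existsPn nl] :=
  boolP [exists a, exists c, (a != c) && same x (inl a) (inl c)].
  exact: step s.
have [/existsP[a /existsP[c /andP[ac s]]]|/existsPn nr] :=
  boolP [exists a, exists c, (a != c) && same x (inr a) (inr c)].
  rewrite -(pinvK px); apply: gen_inv; apply: (step _ _ _ a c) => //.
  - exact: isPI_pinv.
  - by rewrite m_pinv.
  by rewrite same_pinv.
have [|f xE fE] := isPI_phi_pick Px.
  by move=> j l s; apply/eqP; move: (nr j) => /existsPn/(_ l); rewrite s andbT negbK.
rewrite xE; apply: gen_pinj i12 U G _ => i j z /fE si /fE sj; apply/eqP.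
have sij : same x (inl i) (inl j) by apply: same_trans si _; rewrite // same_sym.
by move: (nl i) => /existsPn/(_ j); rewrite sij andbT negbK.
Qed.

(** * Rank, and elements of rank at least n - 1 *)

Definition lines n (x : {set {set pt n}}) : {set {set pt n}} :=
  [set B in x | [exists i, inl i \in B] && [exists j, inr j \in B]].

Definition rank n (x : {set {set pt n}}) : nat := #|lines x|.

Lemma linesP n (x : {set {set pt n}}) B : partition x [set: pt n] ->
  reflect (exists i j, B = pblock x (inl i) /\ same x (inl i) (inr j)) (B \in lines x).
Proof.
move=> px; have tx : trivIset x by case/and3P: px.
rewrite inE; apply: (iffP and3P) => [[Bx /existsP[i iB] /existsP[j jB]]|[i [j [-> s]]]].
  by exists i, j; rewrite /same (def_pblock tx Bx iB).
split; first exact: pblock_in.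
- by apply/existsP; exists i; apply: (same_refl _ px).
by apply/existsP; exists j.
Qed.

Lemma rank_pinv n (x : {set {set pt n}}) : rank (pinv x) <= rank x.
Proof.
apply: leq_trans (leq_imset_card (fun B : {set pt n} => @swap n @: B) _).
apply: subset_leq_card; apply/subsetP => C.
rewrite inE => /and3P[/imsetP[B Bx ->] /existsP[i /imsetP[p pB ip]] /existsP[j /imsetP[q qB jq]]].
apply: imset_f; rewrite inE Bx /=; apply/andP; split; apply/existsP.
  by exists j; have -> : inl j = q by rewrite -[q]swapK -jq.
by exists i; have -> : inr i = p by rewrite -[p]swapK -ip.
Qed.

Lemma rank_star_l n (x y : {set {set pt n}}) :
  isPI x -> partition y [set: pt n] -> rank (star x y) <= rank x.
Proof.
move=> Px py; have px := isPI_part Px; have pz := star_partition x y.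
(* [H] sends a line of [x] to the block of the product through its elements of X. Those elements are
   related, so the choice is immaterial when that block is a line; the default [set0] is never met
   on lines of [x]. *)
pose H (B : {set pt n}) :=
  if [pick i | inl i \in B] is Some i then pblock (star x y) (inl i) else set0.
apply: leq_trans (leq_imset_card H _); apply: subset_leq_card; apply/subsetP => C.
case/linesP=> // i [j [-> s]]; move: s; rewrite same_star /star_rel pt_eqE => /andP[_ np].
have ni : [set inl i] \notin x.
  by apply: contra np => p; apply/has_pointP; left; exists (inl i) => //; apply: connect0.
have [_ [k sk]] := isPI_npoint Px ni.
apply/imsetP; exists (pblock x (inl i)); first by apply/linesP => //; exists i, k.
rewrite /H; case: pickP => [i' si'|/(_ i)]; last by rewrite [_ \in _]same_refl.
apply/eqP; rewrite -sameE // same_star /star_rel np (_ : simrel _ _ _ _) ?orbT //.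
exact: (simA px py si').
Qed.

Lemma rank_star_r n (x y : {set {set pt n}}) :
  isPI x -> isPI y -> rank (star x y) <= rank y.
Proof.
move=> Px Py; have [px py] := (isPI_part Px, isPI_part Py).
rewrite -(pinvK (star_partition x y)) pinv_star //.
apply: leq_trans (rank_pinv _) _; apply: leq_trans (rank_pinv y).
by apply: rank_star_l; [apply: isPI_pinv | apply: pinv_partition].
Qed.

Lemma rank_le n (x : {set {set pt n}}) (s : 'I_n -> {set pt n}) (b c : 'I_n) : b != c ->
  (forall B, B \in lines x -> exists l, [/\ l != b, l != c & B = s l]) ->
  rank x <= n - 2.
Proof.
move=> bc H; have -> : n - 2 = #|~: [set b; c]| by rewrite cardsCs setCK cards2 bc card_ord.
apply: leq_trans (leq_imset_card s _); apply: subset_leq_card; apply/subsetP => B /H.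
by case=> l [lb lc ->]; apply: imset_f; rewrite !inE negb_or lb.
Qed.

(** The map [s] stands for [inl] or [inr], so each side is covered. No line passes through the two
    points, which leaves n - 2 representatives. *)
Lemma rank_points n (x : {set {set pt n}}) (s : 'I_n -> pt n) (b c : 'I_n) : b != c ->
  (forall B, B \in lines x -> exists2 l, B = pblock x (s l) & [set s l] \notin x) ->
  [set s b] \in x -> [set s c] \in x -> rank x <= n - 2.
Proof.
move=> bc H Pb Pc; apply: (rank_le (s := pblock x \o s) bc) => B /H[l -> nl].
by exists l; split=> //; apply: contraNneq nl => ->.
Qed.

(** One representative is lost to the point [b] and another to the coincidence: a line through [k]
    is also represented by [j]. *)
Lemma rank_point_pair n (x : {set {set pt n}}) (s : 'I_n -> pt n) (b j k : 'I_n) :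
  partition x [set: pt n] -> injective s ->
  (forall B, B \in lines x -> exists2 l, B = pblock x (s l) & [set s l] \notin x) ->
  [set s b] \in x -> j != k -> same x (s j) (s k) -> rank x <= n - 2.
Proof.
move=> px si H Pb jk sjk; have Hb := elimT (pointP _ px) Pb.
have bk : b != k.
  by apply: contraNneq jk => bk; rewrite -(inj_eq si) -bk (Hb (s j)) // same_sym // bk.
have jb : j != b.
  by apply: contraNneq jk => jb; rewrite -(inj_eq si) jb (Hb (s k)) // -jb.
apply: (rank_le (s := pblock x \o s) bk) => B /H[l -> nl].
have lb : l != b by apply: contraNneq nl => ->.
have [lk|lk] := eqVneq l k; last by exists l.
by exists j; split=> //=; apply/eqP; rewrite -sameE // same_sym // lk.
Qed.

Lemma lines_inl n (x : {set {set pt n}}) B : partition x [set: pt n] ->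
  B \in lines x -> exists2 i, B = pblock x (inl i) & [set inl i] \notin x.
Proof.
move=> px /linesP[//|i [j [-> s]]]; exists i => //.
by apply/(pointP _ px) => /(_ _ s).
Qed.

Lemma lines_inr n (x : {set {set pt n}}) B : partition x [set: pt n] ->
  B \in lines x -> exists2 j, B = pblock x (inr j) & [set inr j] \notin x.
Proof.
move=> px /linesP[//|i [j [-> s]]]; exists j; first by apply/eqP; rewrite -sameE.
by apply/(pointP _ px) => /(_ (inl i)); rewrite same_sym // => /(_ s).
Qed.

(** Given the point [b] in X', a coincidence in X' would lower the rank to n - 2, so the assumed
    coincidence is in X. Then a point in X would lower it likewise, and so would a second point in
    X'. Hence [u] is a total map onto X minus [b]. *)
Lemma rank_shape n (u : {set {set pt n}}) b : isPI u -> n - 2 < rank u ->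
  [set inr b] \in u ->
  (exists i j, i != j /\ (same u (inl i) (inl j) \/ same u (inr i) (inr j))) ->
  exists2 f : 'I_n -> 'I_n, u = phi (fun x => Some (f x)) &
    (forall x, f x != b) /\ (forall y, y != b -> exists x, f x = y).
Proof.
move=> Pu ru Pb [i0 [j0 [ij0 s0]]]; have pu := isPI_part Pu.
have inrI : injective (@inr 'I_n 'I_n : 'I_n -> pt n) by move=> ? ? [].
have inlI : injective (@inl 'I_n 'I_n : 'I_n -> pt n) by move=> ? ? [].
have lr := fun B => @lines_inr _ _ B pu; have ll := fun B => @lines_inl _ _ B pu.
have ri j k : same u (inr j) (inr k) -> j = k.
  move=> s; apply/eqP/negPn/negP => jk.
  by have := rank_point_pair pu inrI lr Pb jk s; rewrite leqNgt ru.
have {}s0 : same u (inl i0) (inl j0) by case: s0 => // /ri E; rewrite E eqxx in ij0.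
have [f uE _] := isPI_phi_pick Pu ri.
have tot x : f x = Some (odflt x (f x)).
  case fx: (f x) => //; have Px : [set inl x] \in u by rewrite uE point_phi /= fx.
  by have := rank_point_pair pu inlI ll Px ij0 s0; rewrite leqNgt ru.
exists (fun x => odflt x (f x)); first by rewrite uE; apply: eq_phi.
split=> [x|y yb].
  apply/eqP => fb; move: Pb; rewrite uE point_phi => /eqP/(phi_inr_none (x := x)).
  by rewrite tot fb.
have [[x fx]|E] := phi_inr_total f y; first by exists x; rewrite fx.
have Py : [set inr y] \in u by rewrite uE point_phi E.
by have := rank_points yb lr Py Pb; rewrite leqNgt ru.
Qed.

Lemma phi_gamma_factor n (f : 'I_n -> 'I_n) (b i1 i2 : 'I_n) : i1 != i2 ->
  (forall x, f x != b) -> (forall y, y != b -> exists x, f x = y) ->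
  exists s t : {perm 'I_n},
    phi (fun x => Some (f x)) = star (star (permPI s) (gamma i1 i2)) (permPI t).
Proof.
move=> i12 fb fs.
have [a [c [ac fac]]] : exists a c, a != c /\ f a = f c.
  (* An injective self-map of a finite set is onto, but [f] misses [b]. *)
  have [/injectiveP/injF_bij[g _ gK]|/injectivePn[a [c ac E]]] := boolP (injectiveb f).
    by have := fb (g b); rewrite gK eqxx.
  by exists a, c.
have [s [sa sc]] := perm_two ac i12.
(* With [a] and [c] moved to [i1] and [i2], the fold sends both to [i1]. The value of the outer
   permutation at [i2] is therefore free, and taking the missed [b] makes [h] onto, hence
   bijective. *)
pose h k := if k == i2 then b else f (s^-1 k)%g.
have hs x : x != c -> h (s x) = f x by move=> xc; rewrite /h -sc (inj_eq perm_inj) (negbTE xc) permK.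
have h_onto y : exists k, h k = y.
  have [->|/fs[x <-]] := eqVneq y b; first by exists i2; rewrite /h eqxx.
  have [->|xc] := eqVneq x c; last by exists (s x); apply: hs.
  by exists (s a); rewrite hs // ac.
have h_inj : injective h.
  have /image_injP I : #|image h 'I_n| == #|'I_n|.
    apply/eqP; apply: eq_card => y; have [k <-] := h_onto y.
    by rewrite image_f ?inE.
  by move=> x y; apply: I.
exists s, (perm h_inj).
rewrite gamma_phi // star_perm_phi star_phi_perm; apply: eq_phi => x /=.
rewrite permE -sc (inj_eq perm_inj) -sa; case: (eqVneq x c) => [->|xc]; by rewrite hs ?fac.
Qed.


(** * Families closed under product and inverse *)

Lemma gen_invariant n (A P : {set {set pt n}} -> Prop) :
  (forall x, A x -> isPI x /\ P x) ->
  (forall x y, isPI x -> isPI y -> P x -> P y -> P (star x y)) ->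
  (forall x, isPI x -> P x -> P (pinv x)) ->
  forall x, gen A x -> isPI x /\ P x.
Proof.
move=> HA HM HV x; elim=> {x} [//|x y _ [Px Qx] _ [Py Qy]|x _ [Px Qx]].
  by split; [apply: isPI_star | apply: HM].
by split; [apply: isPI_pinv | apply: HV].
Qed.

Lemma isPI_unit n (x : {set {set pt n}}) : isUnit x -> isPI x.
Proof. by case=> s ->; rewrite permPI_phi; apply: isPI_phi. Qed.

Lemma unit_npoint n (x : {set {set pt n}}) p : isUnit x -> [set p] \notin x.
Proof.
case=> s ->; rewrite permPI_phi point_phi; case: p => // y.
by rewrite (@phi_inr _ _ (s^-1 y)%g) ?permKV.
Qed.

Definition pointless n (x : {set {set pt n}}) : Prop := forall p, [set p] \notin x.

Lemma pointless_pinv n (x : {set {set pt n}}) :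
  partition x [set: pt n] -> pointless x -> pointless (pinv x).
Proof. by move=> px Qx p; rewrite point_pinv. Qed.

(** With no points anywhere, no class is lost, and every element can be followed through the middle
    copy to the opposite side. *)
Lemma pointless_star n (x y : {set {set pt n}}) :
  isPI x -> isPI y -> pointless x -> pointless y -> pointless (star x y).
Proof.
move=> Px Py Qx Qy; have [px py] := (isPI_part Px, isPI_part Py).
have np u : ~~ has_point x y u.
  by apply/has_pointP=> [] [] [t tx]; [move: (Qx t) | move: (Qy t)]; rewrite tx.
move=> p; apply/(pointP _ (star_partition x y)) => H.
case: p H => [i|j] H.
  have [_ [j /(simA px py) sj]] := isPI_npoint Px (Qx (inl i)).
  have [_ [k /(simB px py) sk]] := isPI_npoint Py (Qy (inl j)).
  have /H // : same (star x y) (inl i) (inr k).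
  by rewrite same_star /star_rel np (sim_trans sj sk).
have [[i /(simB px py) si] _] := isPI_npoint Py (Qy (inr j)).
have [[k /(simA px py) sk] _] := isPI_npoint Px (Qx (inr i)).
have /H // : same (star x y) (inr j) (inl k).
by rewrite same_star /star_rel np (sim_trans si sk).
Qed.

(* Membership in the symmetric inverse monoid. *)
Definition biinj n (x : {set {set pt n}}) : Prop :=
  (forall i j, same x (inl i) (inl j) -> i = j) /\
  (forall i j, same x (inr i) (inr j) -> i = j).

Lemma biinj_phi n (f : 'I_n -> option 'I_n) : pinj f -> biinj (phi f).
Proof.
move=> fi; split=> i j; rewrite same_phi => /orP[/eqP[]//|/andP[/eqP E]].
  by case fE: (phi_lab f (inl i)) E => [z|] // /esym E _; apply: (fi _ _ z).
case fE: (phi_lab f (inr i)) E => [z|] // /esym E _.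
by case/phi_inr_ex: E => ->; case/phi_inr_ex: fE => ->.
Qed.

Lemma biinjP n (x : {set {set pt n}}) :
  isPI x -> biinj x -> exists2 f, pinj f & x = phi f.
Proof.
move=> Px [li ri]; have px := isPI_part Px.
have [f xE fE] := isPI_phi_pick Px ri; exists f => // i j z /fE si /fE sj.
by apply: li; apply: same_trans si _; rewrite // same_sym.
Qed.

(** Both factors are partial injections, and these compose as maps. *)
Lemma biinj_star n (x y : {set {set pt n}}) :
  isPI x -> isPI y -> biinj x -> biinj y -> biinj (star x y).
Proof.
move=> Px Py /(biinjP Px)[f fi ->] /(biinjP Py)[g gi ->].
rewrite star_phi_pinj //; apply: biinj_phi => i j z.
case Ei: (f i) => [a|] //= ga; case Ej: (f j) => [b|] //= gb.
by apply: fi Ei _; rewrite (gi _ _ _ ga gb).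
Qed.

Lemma biinj_pinv n (x : {set {set pt n}}) : isPI x -> biinj x -> biinj (pinv x).
Proof.
by move=> Px [li ri]; have px := isPI_part Px; split=> i j; rewrite same_pinv //;
   [apply: ri | apply: li].
Qed.

Lemma biinj_unit n (x : {set {set pt n}}) : isUnit x -> biinj x.
Proof. by case=> s ->; rewrite permPI_phi; apply/biinj_phi/pinj_perm. Qed.

Definition small n (x : {set {set pt n}}) : Prop := isUnit x \/ rank x <= n - 2.

(** The rank of a product is at most that of either factor, so only a product of two permutations
    remains. *)
Lemma small_star n (x y : {set {set pt n}}) :
  isPI x -> isPI y -> small x -> small y -> small (star x y).
Proof.
move=> Px Py [[s xE]|rx]; last first.
  by move=> _; right; apply: leq_trans (rank_star_l Px (isPI_part Py)) rx.
case=> [[t yE]|ry]; last by right; apply: leq_trans (rank_star_r Px Py) ry.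
left; exists (s * t)%g; rewrite xE yE {1}permPI_phi star_phi_perm permPI_phi.
by apply: eq_phi => i; rewrite /= permM.
Qed.

Lemma small_pinv n (x : {set {set pt n}}) : small x -> small (pinv x).
Proof.
case=> [[s ->]|rx]; first by left; exists s^-1%g; apply: pinv_permPI.
by right; apply: leq_trans (rank_pinv x) rx.
Qed.

Lemma gamma_point n (i j : 'I_n) : [set inr j] \in gamma i j.
Proof. by rewrite !inE eqxx orbT. Qed.

(** The lines through the elements other than [j] are pairwise distinct. *)
Lemma rank_gamma n (i j : 'I_n) : i != j -> n - 1 <= rank (gamma i j).
Proof.
move=> ij; rewrite gamma_phi //; set f := fold_pt i j.
have pf := phi_partition f; have fE y : y != j -> f y = Some y.
  by rewrite /f /fold_pt => /negbTE->.
have <- : #|[set pblock (phi f) (inl y) | y in [set~ j]]| = n - 1.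
  rewrite card_in_imset => [|y z]; first by rewrite cardsC1 card_ord subn1.
  rewrite !inE => yj zj /eqP; rewrite -sameE // => /same_phi_lab.
  by rewrite /= !fE // => -[].
apply: subset_leq_card; apply/subsetP => B /imsetP[y]; rewrite in_setC1 => yj ->.
by apply/(linesP _ pf); exists y, y; split=> //; apply/same_phi_line/fE.
Qed.

Lemma not_small_gamma n (i j : 'I_n) : 1 < n -> i != j -> ~ small (gamma i j).
Proof.
move=> n1 ij [/(unit_npoint (inr j))|le_r]; first by rewrite gamma_point.
have := leq_trans (rank_gamma ij) le_r.
by rewrite leqNgt ltn_sub2l.
Qed.

(** * Two-sided translates by permutations *)

Lemma gen_conj n (A : {set {set pt n}} -> Prop) (f : 'I_n -> option 'I_n) s t :
  (forall r, gen A (permPI r)) ->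
  gen A (star (star (permPI s) (phi f)) (permPI t)) -> gen A (phi f).
Proof.
move=> U G.
have -> : phi f = star (star (permPI s^-1%g)
    (star (star (permPI s) (phi f)) (permPI t))) (permPI t^-1%g).
  rewrite star_perm_phi star_phi_perm star_perm_phi star_phi_perm; apply: eq_phi => x.
  by rewrite permKV; case: (f x) => //= y; rewrite permK.
by do 2?apply: gen_mul.
Qed.

Lemma perm_partition n (s : {perm 'I_n}) : partition (permPI s) [set: pt n].
Proof. by rewrite permPI_phi; apply: phi_partition. Qed.

(** The left factor renames X and the right one renames X', independently of each other. Right
    translation is read off from left translation by passing to inverses. *)
Lemma star_permA n (s t : {perm 'I_n}) (x : {set {set pt n}}) :
  partition x [set: pt n] ->
  star (permPI s) (star x (permPI t)) = star (star (permPI s) x) (permPI t).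
Proof.
move=> px; have starR y p q : partition y [set: pt n] -> same (star y (permPI t)) p q =
    same (star (permPI t^-1%g) (pinv y)) (swap p) (swap q).
  move=> py; rewrite -same_pinv ?star_partition //.
  rewrite pinv_star ?pinv_partition ?perm_partition // pinvK // pinv_permPI.
  by rewrite invgK.
apply: partition_eq; [exact: star_partition..|move=> p q].
rewrite same_star_perm ?star_partition // !starR ?star_partition //.
rewrite !same_star_perm ?pinv_partition ?star_partition // !same_pinv ?star_partition //.
by rewrite same_star_perm //; case: p q => i [] j.
Qed.

Lemma pinv_conj n (s t : {perm 'I_n}) (x : {set {set pt n}}) :
  partition x [set: pt n] ->
  pinv (star (star (permPI s) x) (permPI t)) =
  star (star (permPI t^-1%g) (pinv x)) (permPI s^-1%g).
Proof.
move=> px; rewrite !pinv_star ?star_partition ?perm_partition // !pinv_permPI.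
by rewrite star_permA // pinv_partition.
Qed.

(** Failure of [biinj] supplies the two related elements on one side that [rank_shape] asks for. *)
Lemma conj_of_rank n (u : {set {set pt n}}) (b i1 i2 : 'I_n) :
  i1 != i2 -> isPI u -> n - 2 < rank u -> ~ biinj u -> [set inr b] \in u ->
  exists s t, u = star (star (permPI s) (gamma i1 i2)) (permPI t).
Proof.
move=> i12 Pu ru nu Pb; have [|f uE [fb fs]] := rank_shape Pu ru Pb.
  have [/existsP[i /existsP[j /andP[ij /orP s]]]|/existsPn H] := boolP
    [exists i, exists j, (i != j) && (same u (inl i) (inl j) || same u (inr i) (inr j))].
    by exists i, j.
  case: nu; split=> i j s; apply/eqP; move: (H i) => /existsPn/(_ j);
  by rewrite s ?orbT andbT negbK.
have [s [t E]] := phi_gamma_factor i12 fb fs.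
by exists s, t; rewrite uE.
Qed.

(** * Single elements that complete the permutations to a generating set *)

Theorem mainTheorem4 (n : nat) (hn : 3 <= n) (i1 i2 : 'I_n)
    (hi1 : nat_of_ord i1 = 0) (hi2 : nat_of_ord i2 = 1) :
  generates (fun y => isUnit y \/ y = gamma i1 i2) /\
  (forall u : {set {set pt n}}, isPI u -> ~ isUnit u ->
     (generates (fun y => isUnit y \/ y = u) <->
      exists g h v : {set {set pt n}}, isUnit g /\ isUnit h /\
        (v = gamma i1 i2 \/ v = pinv (gamma i1 i2)) /\
        u = star (star g v) h)).
Proof.
have i12 : i1 != i2 by apply/eqP => E; move: hi1; rewrite E hi2.
have gE := gamma_phi i12; have Pg : isPI (gamma i1 i2) by rewrite gE; apply: isPI_phi.
have pg := isPI_part Pg.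
have U (u : {set {set pt n}}) (r : {perm 'I_n}) : gen (fun y => isUnit y \/ y = u) (permPI r).
  by apply: gen_base; left; exists r.
split; first by apply: generates_gamma i12 (U _) _; apply: gen_base; right.
move=> u Pu Nu; have pu := isPI_part Pu; split; last first.
  case=> _ [_ [v [[s ->] [[t ->] [vE uE]]]]].
  apply: generates_gamma i12 (U u) _.
  have gu : gen (fun y => isUnit y \/ y = u) u by apply: gen_base; right.
  case: vE uE => -> uE; first by rewrite gE; apply: (gen_conj (s := s) (t := t) (U u)); rewrite -gE -uE.
  (* The inverse of [u] is a translate of [gamma] itself, from which the permutations can be
     stripped. *)
  have := gen_inv gu; rewrite {2}uE pinv_conj ?pinv_partition // pinvK // gE.
  exact: gen_conj (U u).
move=> G; have Gg := G _ Pg.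
(* A closed family that contains the permutations and [u] contains everything generated, in
   particular [gamma]. So [u] lies outside every such family that misses [gamma]. *)
have inv (P : {set {set pt n}} -> Prop) :
    (forall x y, isPI x -> isPI y -> P x -> P y -> P (star x y)) ->
    (forall x, isPI x -> P x -> P (pinv x)) ->
    (forall x, isUnit x -> P x) -> P u -> P (gamma i1 i2).
  move=> HM HV HU Pu'; suff [] : isPI (gamma i1 i2) /\ P (gamma i1 i2) by [].
  apply: (gen_invariant _ HM HV Gg) => x [/[dup] /isPI_unit ? /HU|->//]; by split.
(* In [gamma], the elements [i1] and [i2] of X share a line. *)
have nu : ~ biinj u.
  move/(inv _ (@biinj_star n) (@biinj_pinv n) (@biinj_unit n)) => [/(_ i1 i2)].
  rewrite gE same_phi /phi_rel /= /fold_pt eqxx (negbTE i12) eqxx orbT => /(_ isT) E.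
  by rewrite E eqxx in i12.
have ru : n - 2 < rank u.
  rewrite ltnNge; apply/negP => le_r; have n1 : 1 < n by apply: ltn_trans hn.
  apply: not_small_gamma n1 i12 (inv _ (@small_star n) _ _ _).
  - by move=> x _; apply: small_pinv.
  - by left.
  by right.
have [/existsP[p Pp]|/existsPn np] := boolP [exists p, [set p] \in u]; last first.
  have /(_ (inr i2)) : pointless (gamma i1 i2).
    apply: inv np; [exact: pointless_star | | by move=> x Ux p; apply: unit_npoint].
    by move=> x /isPI_part; apply: pointless_pinv.
  by rewrite gamma_point.
case: p Pp => b Pb; last first.
  have [s [t ->]] := conj_of_rank i12 Pu ru nu Pb.
  by exists (permPI s), (permPI t), (gamma i1 i2); do ![split]; [exists s|exists t|left].
(* A point of [u] in X is a point of its inverse in X', so the inverse is a translate of [gamma],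
   and [u] one of [pinv gamma]. *)
have [|||s [t E]] := conj_of_rank (b := b) i12 (isPI_pinv Pu).
- by apply: leq_trans ru _; rewrite -{1}(pinvK pu); apply: rank_pinv.
- by move/(biinj_pinv (isPI_pinv Pu)); rewrite pinvK.
- by rewrite point_pinv.
exists (permPI t^-1%g), (permPI s^-1%g), (pinv (gamma i1 i2)).
do ![split]; [by exists t^-1%g|by exists s^-1%g|by right|].
by rewrite -(pinvK pu) E pinv_conj.
Qed.
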